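(* Let $B$ be a unital $C^*$-algebra with an action $\alpha$ by a discrete group $\Gamma$ and let $A=B\times_\alpha\Gamma$ be the (full) crossed product. If $\Gamma$ has property $(T)$, then $(A,B)$ is strongly co-rigid. Consequently, if $B$ has strong property $(T)$ and $\Gamma$ has property $(T)$, then $A$ has strong property $(T)$, and so does the reduced crossed product $B\times_{\alpha,r}\Gamma$.
   Context: Let $A$ be a unital $C^*$-algebra and $B\subseteq A$ a $C^*$-subalgebra containing the identity of $A$ (for the crossed product, $B$ is identified with its canonical copy). A unital Hilbert bimodule over $A$ is a Hilbert space $H$ with commuting unital left and right actions of $A$ coming from a non-degenerate $*$-representation of $A\otimes_{\max}A^{\rm op}$, with $(a\otimes b^{\rm op})\xi=a\cdot\xi\cdot b$ ($A^{\rm op}$ is the opposite $C^*$-algebra). For such $H$, $H^B:=\{\xi\in H: b\cdot\xi=\xi\cdot b\text{ for all }b\in B\}$, $P^B_H:H\to H^B$ is the orthogonal projection (and similarly $H^A$, $P^A_H$). For a non-empty finite $Q\subseteq A$ and $\beta>0$, $V_H(Q,\beta):=\{\xi\in H:\|\xi\|=1,\ \|x\cdot\xi-\xi\cdot x\|<\beta\text{ for all }x\in Q\}$. A unital $C^*$-algebra $A$ has strong property $(T)$ if for any $\alpha>0$ there exist a non-empty finite $Q\subseteq A$ and $\beta>0$ such that for any unital Hilbert bimodule $H$ over $A$ and any $\xi\in V_H(Q,\beta)$, $\|\xi-P^A_H(\xi)\|<\alpha$. The pair $(A,B)$ is strongly co-rigid if for any $\gamma>0$ there exist a non-empty finite $Q\subseteq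 A$ and $\delta>0$ such that for any unital Hilbert bimodule $H$ over $A$ and any $\xi\in V_H(Q,\delta)\cap H^B$, $\|\xi-P^A_H(\xi)\|<\gamma$. A discrete group $\Gamma$ has property $(T)$ if there exist a non-empty finite $F\subseteq\Gamma$ and $\epsilon>0$ such that every unitary representation $(\pi,K)$ of $\Gamma$ having a unit vector $\xi$ with $\|\pi(t)\xi-\xi\|<\epsilon$ for all $t\in F$ has a non-zero $\Gamma$-invariant vector. *)

(* Defs.v *)
From HB Require Import structures.
From mathcomp Require Import all_boot all_order all_algebra.
From mathcomp Require Import finmap complex.
From mathcomp Require Import all_classical all_reals all_analysis.

Set Implicit Arguments.
Unset Strict Implicit.
Unset Printing Implicit Defensive.

Import Order.TTheory GRing.Theory Num.Theory.
Import numFieldNormedType.Exports.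

Local Open Scope classical_set_scope.
Local Open Scope ring_scope.

(* Complex Hilbert spaces; the inner product is linear on the left. *)
HB.mixin Record isHilbert (R : realType) H of CompleteNormedModule R[i] H := {
  dot : H -> H -> R[i];
  dotDZl : forall (c : R[i]) (x y z : H),
    dot (c *: x + y) z = c * dot x z + dot y z;
  dotC : forall x y : H, dot y x = (dot x y)^*;
  dotxx : forall x : H, dot x x = `|x| ^+ 2
}.

#[short(type="hilbertType")]
HB.structure Definition Hilbert (R : realType) :=
  {H of isHilbert R H & CompleteNormedModule R[i] H}.

(* MathComp norms on a space over [R[i]] take their values in [R[i]]; this is
   the same norm as an element of [R]. *)
Definition hnorm (R : realType) (H : hilbertType R) (x : H) : R :=
  complex.Re `|x|.

(* Unital (nonzero) C*-algebras over the complex numbers [R[i]]. The norm is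
   part of the mixin because Hierarchy Builder does not allow a join of the
   library's rings and normed modules besides [numDomainType]. *)
HB.mixin Record isCstarAlg (R : realType) A of GRing.Algebra R[i] A := {
  star : A -> A;
  cnorm : A -> R;
  starK : involutive star;
  starDZ : forall (c : R[i]) (x y : A),
    star (c *: x + y) = c^* *: star x + star y;
  starM : forall x y : A, star (x * y) = star y * star x;
  cnorm_eq0 : forall x : A, cnorm x = 0 -> x = 0;
  cnormD : forall x y : A, cnorm (x + y) <= cnorm x + cnorm y;
  cnormZ : forall (c : R[i]) (x : A), cnorm (c *: x) = complex.Re `|c| * cnorm x;
  cnormM : forall x y : A, cnorm (x * y) <= cnorm x * cnorm y;
  cnorm_starM : forall x : A, cnorm (star x * x) = cnorm x ^+ 2;
  cnorm_complete : forall v : nat -> A,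
    (forall e : R, 0 < e -> exists N : nat, forall m n : nat,
      (N <= m)%N -> (N <= n)%N -> cnorm (v m - v n) < e) ->
    exists l : A, forall e : R, 0 < e -> exists N : nat, forall n : nat,
      (N <= n)%N -> cnorm (v n - l) < e
}.

#[short(type="cstarAlgType")]
HB.structure Definition CstarAlg (R : realType) :=
  {A of isCstarAlg R A & GRing.Algebra R[i] A}.

(* The opposite C*-algebra lives on MathComp's converse ring [A^c]: the product
   is reversed, everything else is that of [A]. *)
Section Opposite.
Variables (R : realType) (A : cstarAlgType R).

HB.instance Definition _ := GRing.Lmodule.copy A^c A.

Let op_scaleAl (c : R[i]) (x y : A^c) : c *: (x * y) = (c *: x : A^c) * y.
Proof. exact: (@scalerAr _ A c y x). Qed.

HB.instance Definition _ :=
  GRing.LSemiModule_isLSemiAlgebra.Build R[i] A^c op_scaleAl.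

Let op_scaleAr (c : R[i]) (x y : A^c) : c *: (x * y) = x * (c *: y : A^c).
Proof. exact: (@scalerAl _ A c y x). Qed.

HB.instance Definition _ :=
  GRing.LSemiAlgebra_isSemiAlgebra.Build R[i] A^c op_scaleAr.

Let op_star (x : A^c) : A^c := @star R A x.
Let op_cnorm (x : A^c) : R := @cnorm R A x.

Let op_starK : involutive op_star.
Proof. exact: (@starK R A). Qed.

Let op_starDZ (c : R[i]) (x y : A^c) :
  op_star (c *: x + y) = (c^* *: op_star x : A^c) + op_star y.
Proof. exact: (@starDZ R A). Qed.

Let op_starM (x y : A^c) : op_star (x * y) = op_star y * op_star x.
Proof. exact: (@starM R A y x). Qed.

Let op_cnormM (x y : A^c) : op_cnorm (x * y) <= op_cnorm x * op_cnorm y.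
Proof. by rewrite mulrC; exact: (@cnormM R A y x). Qed.

Let cnorm_star_le (x : A) : cnorm x <= cnorm (star x).
Proof.
have cnorm_ge0 (y : A) : 0 <= cnorm y.
  have n0 : cnorm (0 : A) = 0.
    by rewrite -(scale0r (0 : A)) cnormZ normr0 mul0r.
  have := cnormD y (- y); rewrite subrr n0 -scaleN1r cnormZ normrN1 mul1r.
  by rewrite -mulr2n pmulrn_lge0.
have := cnormM (star x) x; rewrite cnorm_starM expr2.
have [->|nx] := eqVneq (cnorm x) 0; first by rewrite cnorm_ge0.
by rewrite ler_pM2r // lt_def nx cnorm_ge0.
Qed.

Let op_cnorm_starM (x : A^c) : op_cnorm (op_star x * x) = op_cnorm x ^+ 2.
Proof.
have -> : op_cnorm x = cnorm (star (x : A)).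
  apply/eqP; rewrite eq_le cnorm_star_le /=.
  by have := cnorm_star_le (star (x : A)); rewrite starK.
by rewrite -cnorm_starM starK.
Qed.

HB.instance Definition _ := @isCstarAlg.Build R A^c op_star op_cnorm
  op_starK op_starDZ op_starM (@cnorm_eq0 R A) (@cnormD R A) (@cnormZ R A)
  op_cnormM op_cnorm_starM (@cnorm_complete R A).
End Opposite.

Section Representations.
Variable R : realType.

Record unital_star_hom (A D : cstarAlgType R) (f : A -> D) : Prop := {
  star_hom_linear : linear f;
  star_hom_mul : forall x y : A, f (x * y) = f x * f y;
  star_hom_one : f 1 = 1;
  star_hom_star : forall x : A, f (star x) = star (f x)
}.

(* Unital (equivalently, non-degenerate) *-representations by bounded operators. *)
Record star_rep (A : cstarAlgType R) (H : hilbertType R) (pi : A -> H -> H)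
    : Prop := {
  rep_op_linear : forall a : A, linear (pi a);
  rep_op_bounded : forall a : A, continuous (pi a);
  rep_linear : forall (c : R[i]) (a b : A) (x : H),
    pi (c *: a + b) x = c *: pi a x + pi b x;
  rep_mul : forall (a b : A) (x : H), pi (a * b) x = pi a (pi b x);
  rep_one : forall x : H, pi 1 x = x;
  rep_star : forall (a : A) (x y : H), dot (pi a x) y = dot x (pi (star a) y)
}.

Record unitary_rep (G : groupType) (H : hilbertType R) (U : G -> H -> H)
    : Prop := {
  urep_linear : forall t : G, linear (U t);
  urep_mul : forall (s t : G) (x : H), U (s * t)%g x = U s (U t x);
  urep_one : forall x : H, U 1%g x = x;
  urep_dot : forall (t : G) (x y : H), dot (U t x) (U t y) = dot x y
}.

Definition property_T (G : groupType) : Prop :=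
  exists (F : set G) (e : R), [/\ finite_set F, F !=set0, 0 < e &
    forall (K : hilbertType R) (U : G -> K -> K), unitary_rep U ->
      (exists x : K, hnorm x = 1 /\ forall t, F t -> hnorm (U t x - x) < e) ->
      exists y : K, y != 0 /\ forall t : G, U t y = y].

End Representations.

Section Bimodules.
Variable R : realType.

(* By the universal property of the maximal tensor product, a non-degenerate
   *-representation of [A (x)_max A^op] is the same thing as a commuting pair
   of unital *-representations of [A] and [A^op]. *)
Definition hilbert_bimodule (A : cstarAlgType R) (H : hilbertType R)
    (l : A -> H -> H) (r : H -> A -> H) : Prop :=
  [/\ star_rep l,
      @star_rep R A^c H (fun b x => r x b) &
      forall (a b : A) (x : H), l a (r x b) = r (l a x) b].

(* [H^B] *)
Definition central (A : cstarAlgType R) (H : hilbertType R)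
    (l : A -> H -> H) (r : H -> A -> H) (B : set A) : set H :=
  [set x | forall b, B b -> l b x = r x b].

(* For a closed subspace [S] there is exactly one such [p]. *)
Definition orth_proj (H : hilbertType R) (S : set H) (x : H) : H :=
  xget 0 [set p | S p /\ forall s, S s -> dot (x - p) s = 0].

(* [V_H(Q, b)] *)
Definition almost_central (A : cstarAlgType R) (H : hilbertType R)
    (l : A -> H -> H) (r : H -> A -> H) (Q : set A) (b : R) : set H :=
  [set x | hnorm x = 1 /\ forall a, Q a -> hnorm (l a x - r x a) < b].

Definition strong_property_T (A : cstarAlgType R) : Prop :=
  forall a : R, 0 < a ->
  exists (Q : set A) (b : R), [/\ finite_set Q, Q !=set0, 0 < b &
    forall (H : hilbertType R) (l : A -> H -> H) (r : H -> A -> H),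
      hilbert_bimodule l r ->
      forall x, almost_central l r Q b x ->
      hnorm (x - orth_proj (central l r setT) x) < a].

(* [B] is the underlying set of a C*-subalgebra of [A] containing [1]. *)
Definition strongly_corigid (A : cstarAlgType R) (B : set A) : Prop :=
  forall c : R, 0 < c ->
  exists (Q : set A) (d : R), [/\ finite_set Q, Q !=set0, 0 < d &
    forall (H : hilbertType R) (l : A -> H -> H) (r : H -> A -> H),
      hilbert_bimodule l r ->
      forall x, (almost_central l r Q d `&` central l r B) x ->
      hnorm (x - orth_proj (central l r setT) x) < c].

End Bimodules.

Section CrossedProducts.
Variables (R : realType) (G : groupType) (B : cstarAlgType R).
Variable act : G -> B -> B.

Record star_action : Prop := {
  action_hom : forall t : G, unital_star_hom (act t);
  action_one : forall b : B, act 1%g b = b;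
  action_mul : forall (s t : G) (b : B), act (s * t)%g b = act s (act t b)
}.

Record covariant_rep (K : hilbertType R) (pi : B -> K -> K) (U : G -> K -> K)
    : Prop := {
  cov_pi : star_rep pi;
  cov_U : unitary_rep U;
  covariance : forall (t : G) (b : B) (x : K),
    U t (pi b x) = pi (act t b) (U t x)
}.

(* The image in [A] of the element [\sum_(t in F) f(t) t] of [C_c(G, B)]. *)
Definition cross_sum (A : cstarAlgType R) (iota : B -> A) (u : G -> A)
    (F : {fset G}) (f : G -> B) : A :=
  \sum_(t <- F) iota (f t) * u t.

(* [iota] and [u] induce a unital *-homomorphism with dense range from the
   twisted convolution algebra [C_c(G, B)] to [A]. *)
Record covariant_pair (A : cstarAlgType R) (iota : B -> A) (u : G -> A)
    : Prop := {
  pair_iota : unital_star_hom iota;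
  pair_one : u 1%g = 1;
  pair_mul : forall s t : G, u (s * t)%g = u s * u t;
  pair_star : forall t : G, star (u t) = u t^-1%g;
  pair_cov : forall (t : G) (b : B),
    u t * iota b * star (u t) = iota (act t b);
  pair_dense : forall (a : A) (e : R), 0 < e ->
    exists (F : {fset G}) (f : G -> B), cnorm (a - cross_sum iota u F f) < e
}.

(* [A] is the completion of [C_c(G, B)] in the universal norm, the supremum of
   the operator norms over all covariant representations. *)
Definition full_crossed_product (A : cstarAlgType R) (iota : B -> A) (u : G -> A)
    : Prop :=
  covariant_pair iota u /\
  forall (F : {fset G}) (f : G -> B),
    (cnorm (cross_sum iota u F f))%:E =
    ereal_sup [set z | exists (K : hilbertType R) (pi : B -> K -> K)
                              (U : G -> K -> K) (x : K),
      [/\ covariant_rep pi U, hnorm x <= 1 &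
          z = (hnorm (\sum_(t <- F) pi (f t) (U t x)))%:E]].

(* The norm of [l^2(G, K)]; it is [+oo] outside that space. *)
Definition l2norm (K : hilbertType R) (xi : G -> K) : \bar R :=
  sqrte (\esum_(t in [set: G]) ((hnorm (xi t)) ^+ 2)%:E).

(* The regular representation on [l^2(G, K)] induced by a representation
   [sigma] of [B] on [K]:
   [(b xi)(t) = sigma(act t^-1 b)(xi t)] and [(s xi)(t) = xi(s^-1 t)]. *)
Definition regular_rep (K : hilbertType R) (sigma : B -> K -> K)
    (F : {fset G}) (f : G -> B) (xi : G -> K) : G -> K :=
  fun t => \sum_(s <- F) sigma (act t^-1%g (f s)) (xi (s^-1 * t)%g).

(* [A] is the completion of [C_c(G, B)] in the operator norm of the regular
   representation induced by a faithful representation of [B]; this norm does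
   not depend on the faithful representation. *)
Definition reduced_crossed_product (A : cstarAlgType R) (iota : B -> A)
    (u : G -> A) : Prop :=
  covariant_pair iota u /\
  exists (K : hilbertType R) (sigma : B -> K -> K),
    [/\ star_rep sigma, injective sigma &
    forall (F : {fset G}) (f : G -> B),
      (cnorm (cross_sum iota u F f))%:E =
      ereal_sup [set l2norm (regular_rep sigma F f xi) |
                 xi in [set xi : G -> K | (l2norm xi <= 1)%E]]].

End CrossedProducts.

(* Main.v *)
(* The full and the reduced crossed product are treated alike, as algebras
   generated by a covariant pair [(iota, u)]. On a bimodule [H] put
   [U_t x = u_t x u_t^-1]; this is a unitary representation of [G] which
   preserves [H^B], whose fixed vectors in [H^B] are [H^A], and for which
   [|U_t x - x| = |u_t x - x u_t|]. Property (T) applied to the orthogonal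
   complement of [H^A] in [H^B], where there are no nonzero invariant vectors,
   bounds the distance of [x] to [H^A] by its displacement, and this is strong
   co-rigidity. That vectors fixed by [U] in [H^B] commute with all of [A]
   follows by density because *-representations of [A] are contractive. *)
Require Import Defs.
From HB Require Import structures.
From mathcomp Require Import all_boot all_order all_algebra.
From mathcomp Require Import finmap complex.
From mathcomp Require Import all_classical all_reals all_analysis.
From mathcomp Require Import ring lra.

Set Implicit Arguments.
Unset Strict Implicit.
Unset Printing Implicit Defensive.

Import Order.TTheory GRing.Theory Num.Theory.
Import numFieldNormedType.Exports.

Local Open Scope classical_set_scope.
Local Open Scope ring_scope.

(** * Elementary geometry of Hilbert spaces *)

Section HilbertGeometry.
Variables (R : realType) (H : hilbertType R).
Implicit Types (x y z : H) (c : R[i]).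
Local Notation re := (@complex.Re R).

(** A nonnegative element of [R[i]] has zero imaginary part, so passing to the real part loses
    nothing. *)
Lemma hnormE x : `|x| = (hnorm x)%:C%C.
Proof.
have : 0 <= `|x| := normr_ge0 x.
rewrite /hnorm; case: `|x| => a b; rewrite lecE /= => /andP[/eqP -> _].
by [].
Qed.

Lemma hnorm_ge0 x : 0 <= hnorm x.
Proof. by rewrite -lecR -hnormE normr_ge0. Qed.

Lemma hnorm0 : hnorm (0 : H) = 0.
Proof. by rewrite /hnorm normr0. Qed.

Lemma hnorm_eq0 x : (hnorm x == 0) = (x == 0).
Proof. by rewrite -[RHS]normr_eq0 hnormE -complexr0 eq_complex /= eqxx andbT. Qed.

Lemma hnorm_opp x : hnorm (- x) = hnorm x.
Proof. by rewrite /hnorm normrN. Qed.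

Lemma hdistC x y : hnorm (x - y) = hnorm (y - x).
Proof. by rewrite -hnorm_opp opprB. Qed.

Lemma ler_hnormD x y : hnorm (x + y) <= hnorm x + hnorm y.
Proof. by have := ler_normD x y; rewrite !hnormE -rmorphD lecR. Qed.

Lemma hdistD y x z : hnorm (x - z) <= hnorm (x - y) + hnorm (y - z).
Proof. by have := ler_hnormD (x - y) (y - z); rewrite addrA subrK. Qed.

Lemma hnormZ c x : hnorm (c *: x) = re `|c| * hnorm x.
Proof.
by rewrite /hnorm normrZ [X in _ * X]hnormE; case: `|c| => a b /=; rewrite mulr0 subr0.
Qed.

Lemma re_norm_real (t : R) : re `|t%:C%C| = `|t|.
Proof. by rewrite normc_def /= expr0n addr0 sqrtr_sqr. Qed.

Lemma hnormZr (t : R) x : hnorm (t%:C%C *: x) = `|t| * hnorm x.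
Proof. by rewrite hnormZ re_norm_real. Qed.

Lemma hnorm_normalize x : x != 0 -> hnorm ((hnorm x)^-1%:C%C *: x) = 1.
Proof.
rewrite -hnorm_eq0 => x0.
by rewrite hnormZr normfV ger0_norm ?hnorm_ge0 // mulVf.
Qed.

Lemma dotDl x y z : dot (x + y) z = dot x z + dot y z.
Proof. by rewrite -[x]scale1r dotDZl mul1r scale1r. Qed.

Lemma dot0l z : dot (0 : H) z = 0.
Proof. by have := dotDl 0 0 z; rewrite addr0 -{1}[dot 0 z]addr0 => /addrI. Qed.

Lemma dotZl c x z : dot (c *: x) z = c * dot x z.
Proof. by rewrite -[c *: x]addr0 dotDZl dot0l addr0. Qed.

Lemma dotNl x z : dot (- x) z = - dot x z.
Proof. by rewrite -scaleN1r dotZl mulN1r. Qed.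

Lemma dotBl x y z : dot (x - y) z = dot x z - dot y z.
Proof. by rewrite dotDl dotNl. Qed.

Lemma dotDr x y z : dot x (y + z) = dot x y + dot x z.
Proof. by rewrite dotC dotDl rmorphD /= -!(dotC _ x). Qed.

Lemma dotZr c x z : dot x (c *: z) = c^* * dot x z.
Proof. by rewrite dotC dotZl rmorphM /= -dotC. Qed.

Lemma dotNr x z : dot x (- z) = - dot x z.
Proof. by rewrite -scaleN1r dotZr rmorphN1 mulN1r. Qed.

Lemma re_dotC x y : re (dot y x) = re (dot x y).
Proof. by rewrite dotC; case: (dot x y). Qed.

Lemma re_dotxx x : re (dot x x) = hnorm x ^+ 2.
Proof. by rewrite dotxx hnormE -rmorphXn. Qed.

Lemma dotxx_eq0 x : dot x x = 0 -> x = 0.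
Proof. by rewrite dotxx => /eqP; rewrite sqrf_eq0 normr_eq0 => /eqP. Qed.

Lemma sqr_hnormD x y :
  hnorm (x + y) ^+ 2 = hnorm x ^+ 2 + re (dot x y) *+ 2 + hnorm y ^+ 2.
Proof.
rewrite -!re_dotxx dotDl !dotDr !raddfD /= (re_dotC x y) mulr2n; ring.
Qed.

Lemma sqr_hnormB x y :
  hnorm (x - y) ^+ 2 = hnorm x ^+ 2 - re (dot x y) *+ 2 + hnorm y ^+ 2.
Proof. by rewrite sqr_hnormD dotNr hnorm_opp raddfN /= mulNrn. Qed.

Lemma parallelogram x y :
  hnorm (x + y) ^+ 2 + hnorm (x - y) ^+ 2 = (hnorm x ^+ 2 + hnorm y ^+ 2) *+ 2.
Proof. by rewrite sqr_hnormD sqr_hnormB mulr2n; ring. Qed.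

(* The triangle inequality, squared, is the Cauchy-Schwarz inequality. *)
Lemma re_dot_le x y : re (dot x y) <= hnorm x * hnorm y.
Proof.
have := ler_hnormD x y.
rewrite -ler_sqr ?nnegrE ?addr_ge0 ?hnorm_ge0 // sqr_hnormD sqrrD.
rewrite !mulr2n; lra.
Qed.

Lemma hnorm_eq_from_dot (T : H -> H) :
  (forall x y, dot (T x) (T y) = dot x y) -> forall x, hnorm (T x) = hnorm x.
Proof.
move=> h x; apply/eqP; rewrite -(eqrXn2 (n := 2)) ?hnorm_ge0 //.
by rewrite -!re_dotxx h.
Qed.

(** Translates completeness for filters with radii in [R[i]] into sequences with real radii; a
    positive radius in [R[i]] is real. *)
Lemma hcauchy_cvg (v : nat -> H) :
  (forall e : R, 0 < e -> exists N : nat, forall m n : nat,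
      (N <= m)%N -> (N <= n)%N -> hnorm (v m - v n) < e) ->
  exists l : H, forall e : R, 0 < e -> exists N : nat, forall n : nat,
      (N <= n)%N -> hnorm (v n - l) < e.
Proof.
move=> vC.
have /cauchy_cvg/cvg_ex[l vl] : cauchy (v @ \oo).
  apply/cauchy_ballP => e e0.
  have /andP[e1 e2] : (complex.Im e == 0) && (0 < re e) by move: e0; rewrite ltcE.
  have [N NP] := vC _ e2.
  exists ([set v n | n in [set n | (N <= n)%N]], [set v n | n in [set n | (N <= n)%N]]).
    by split; exists N => // n /= Nn; exists n.
  move=> [_ _] /= [[m Nm <-] [n Nn <-]]; rewrite -ball_normE /= hnormE.
  by rewrite ltcE (eqP e1) eqxx NP.
exists l => e e0; have e0' : 0 < e%:C%C by rewrite ltcR.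
have /cvgrPdist_lt /(_ _ e0') [N _ NP] := vl.
exists N => n Nn; have := NP n Nn; rewrite /= hnormE ltcR hdistC.
by [].
Qed.

End HilbertGeometry.

(** * Closed subspaces and orthogonal projections *)

Record closed_subspace (R : realType) (H : hilbertType R) (S : set H) : Prop := {
  subspace0 : S 0;
  subspaceDZ : forall (c : R[i]) (x y : H), S x -> S y -> S (c *: x + y);
  subspace_closed : forall x : H,
    (forall e : R, 0 < e -> exists2 y, S y & hnorm (x - y) < e) -> S x
}.

Section Projection.
Variables (R : realType) (H : hilbertType R) (S : set H).
Hypothesis S_sub : closed_subspace S.
Implicit Types (x y z : H) (c : R[i]).
Local Notation re := (@complex.Re R).

Lemma subspaceD x y : S x -> S y -> S (x + y).
Proof. by move=> Sx Sy; rewrite -[x]scale1r; apply: (subspaceDZ S_sub). Qed.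

Lemma subspaceZ c x : S x -> S (c *: x).
Proof.
by move=> Sx; rewrite -[c *: x]addr0; apply: (subspaceDZ S_sub) => //; apply: subspace0.
Qed.

Lemma subspaceB x y : S x -> S y -> S (x - y).
Proof. by move=> Sx Sy; rewrite -scaleN1r; apply/subspaceD/subspaceZ. Qed.

(** Variational argument: [q + s] stays in [S], so expanding [|x - q - s|^2 >= D] and letting [q]
    tend to [p] gives [2 Re <x - p, s> <= |s|^2]; rescaling [s] then forces the inner product to
    vanish. *)
Lemma orth_of_minimizing_dist x p (D : R) :
  (forall s, S s -> D <= hnorm (x - s) ^+ 2) ->
  (forall e : R, 0 < e -> exists q,
     [/\ S q, hnorm (q - p) < e & hnorm (x - q) ^+ 2 < D + e]) ->
  forall s, S s -> dot (x - p) s = 0.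
Proof.
move=> Dmin Dinf.
have re_bound s : S s -> re (dot (x - p) s) *+ 2 <= hnorm s ^+ 2.
  move=> Ss; apply/ler_addgt0Pr => e e0.
  (* With this [d], the error [d] from [|x - q|^2] and the error [2 d |s|] from replacing [q] by [p]
     add up to [e]. *)
  have d0 : 0 < e / (1 + hnorm s *+ 2).
    by rewrite divr_gt0 // ltr_wpDr ?mulrn_wge0 ?hnorm_ge0.
  have [q [Sq qp qD]] := Dinf _ d0.
  have := Dmin _ (subspaceD Sq Ss).
  rewrite opprD addrA sqr_hnormB => qs.
  have -> : x - p = (x - q) + (q - p) by rewrite addrA subrK.
  rewrite dotDl raddfD /=.
  have qps := re_dot_le (q - p) s.
  have qps' : hnorm (q - p) * hnorm s <= e / (1 + hnorm s *+ 2) * hnorm s.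
    by rewrite ler_wpM2r ?hnorm_ge0 // ltW.
  have ee : e / (1 + hnorm s *+ 2) * (1 + hnorm s *+ 2) = e.
    by rewrite divfK // gt_eqF // ltr_wpDr ?mulrn_wge0 ?hnorm_ge0.
  rewrite mulrDr mulr1 mulrnAr in ee.
  move: qs qps qps' ee qD; rewrite !mulr2n.
  move: (e / _) => d; lra.
have re_orth s : S s -> re (dot (x - p) s) = 0.
  move=> Ss; set r := re _.
  (* For [t = r / (N + 1)] with [N = |s|^2], the bound at [t s] reads [2 t^2 (N + 1) <= t^2 N],
     hence [t = 0]. *)
  have := re_bound _ (subspaceZ (r / (hnorm s ^+ 2 + 1))%:C%C Ss).
  set t := r / _; rewrite dotZr hnormZr exprMn real_normK ?num_real //.
  have -> : t%:C%C^* = t%:C%C :> R[i] by apply/CrealP; rewrite complex_real.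
  have -> : re (t%:C%C * dot (x - p) s) = t * r.
    by rewrite /r; case: (dot _ _) => a b /=; rewrite mul0r subr0.
  have N1 : 0 < hnorm s ^+ 2 + 1 by rewrite ltr_wpDl ?exprn_ge0 ?hnorm_ge0.
  have -> : r = t * (hnorm s ^+ 2 + 1) by rewrite /t divfK // gt_eqF.
  have N0 : 0 <= hnorm s ^+ 2 by rewrite exprn_ge0 ?hnorm_ge0.
  move: (hnorm s ^+ 2) N0 N1 => N N0 N1.
  rewrite mulr2n => h.
  have : t ^+ 2 <= 0 by rewrite expr2 in h *; nra.
  by rewrite le_eqVlt ltNge sqr_ge0 orbF sqrf_eq0 => /eqP ->; rewrite mul0r.
move=> s Ss; apply/eqP; rewrite eq_complex re_orth //= eqxx /=.
(* The imaginary part is the real part of the product with [i s]. *)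
have := re_orth _ (subspaceZ 'i%C Ss); rewrite dotZr.
case: (dot _ _) => a b /=; rewrite mul0r mulN1r sub0r opprK.
by move=> ->.
Qed.

(** A minimizing sequence for the distance to [S] is Cauchy: midpoints of its terms lie in [S], so
    the parallelogram law bounds [|v m - v n|^2] by twice the sum of the two excesses over the
    infimum. Its limit is the projection. *)
Lemma orth_projP x :
  S (orth_proj S x) /\ forall s, S s -> dot (x - orth_proj S x) s = 0.
Proof.
suff [p pP] : exists p, S p /\ forall s, S s -> dot (x - p) s = 0.
  by rewrite /orth_proj; case: xgetP => [y _ //|/(_ p)].
pose E := [set hnorm (x - s) ^+ 2 | s in S].
have E0 : has_inf E.
  split; first by exists (hnorm (x - 0) ^+ 2), 0 => //; exact: (subspace0 S_sub).
  by exists 0 => _ [s _ <-]; rewrite exprn_ge0 ?hnorm_ge0.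
have Dmin s : S s -> inf E <= hnorm (x - s) ^+ 2.
  by move=> Ss; apply: ge_inf; [case: E0|exists s].
have near_inf (e : R) : 0 < e -> exists s, S s /\ hnorm (x - s) ^+ 2 < inf E + e.
  by move=> e0; have [_ [s Ss <-] h] := inf_adherent e0 E0; exists s.
have ngt0 n : 0 < n.+1%:R^-1 :> R by rewrite invr_gt0 ltr0n.
pose v n := projT1 (cid (near_inf _ (ngt0 n))).
have vP n : S (v n) /\ hnorm (x - v n) ^+ 2 < inf E + n.+1%:R^-1.
  exact: (projT2 (cid (near_inf _ (ngt0 n)))).
have small (e : R) : 0 < e -> exists N, forall n, (N <= n)%N -> n.+1%:R^-1 < e.
  by move=> e0; have [N _ NP] := near_infty_natSinv_lt (PosNum e0); exists N.
have vD m n : hnorm (v m - v n) ^+ 2 <= (m.+1%:R^-1 + n.+1%:R^-1) *+ 2.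
  have [Sm m1] := vP m; have [Sn n1] := vP n.
  have := parallelogram (x - v m) (x - v n).
  have -> : x - v m - (x - v n) = v n - v m.
    by rewrite opprB addrC addrA subrK.
  have -> : x - v m + (x - v n) = 2%:R%:C%C *: (x - 2^-1%:C%C *: (v m + v n)).
    rewrite scalerBr scalerA -rmorphM divff ?pnatr_eq0 // scale1r.
    by rewrite rmorph_nat scaler_nat mulr2n opprD addrACA.
  have := Dmin _ (subspaceZ 2^-1%:C%C (subspaceD Sm Sn)).
  have e4 : 2 ^+ 2 = 4 :> R by rewrite -natrX.
  rewrite hnormZr exprMn ger0_norm ?ler0n // e4 (hdistC (v n)) !mulr2n; move: m1 n1.
  move: (m.+1%:R^-1) (n.+1%:R^-1) => em en; lra.
have [p vp] : exists l, forall e : R, 0 < e -> exists N : nat, forall n : nat,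
      (N <= n)%N -> hnorm (v n - l) < e.
  apply: hcauchy_cvg => e e0; have e20 : 0 < e ^+ 2 / 4.
    by rewrite divr_gt0 ?exprn_gt0.
  have [N NP] := small _ e20; exists N => m n Nm Nn.
  rewrite -(@ltr_pXn2r _ 2) ?nnegrE ?hnorm_ge0 ?(ltW e0) //.
  have := vD m n; have := NP _ Nm; have := NP _ Nn; rewrite mulr2n.
  move: (m.+1%:R^-1) (n.+1%:R^-1) => em en; lra.
exists p; split.
  apply: (subspace_closed S_sub) => e /vp [N NP]; exists (v N); first by case: (vP N).
  by rewrite hdistC NP.
apply: (orth_of_minimizing_dist Dmin) => e e0.
have [N NP] := vp _ e0; have [N' NP'] := small _ e0.
exists (v (maxn N N')); case: (vP (maxn N N')) => Sv v1; split => //.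
  by rewrite NP ?leq_maxl.
by rewrite (lt_trans v1) // ltrD2l NP' ?leq_maxr.
Qed.

Lemma orth_proj_mem x : S (orth_proj S x).
Proof. by case: (orth_projP x). Qed.

Lemma orth_proj_orth x s : S s -> dot (x - orth_proj S x) s = 0.
Proof. by case: (orth_projP x) => _; apply. Qed.

(** Pythagoras, since [orth_proj S x - s] lies in [S]. *)
Lemma orth_proj_le x s : S s -> hnorm (x - orth_proj S x) <= hnorm (x - s).
Proof.
move=> Ss; rewrite -ler_sqr ?nnegrE ?hnorm_ge0 //.
have -> : x - s = (x - orth_proj S x) + (orth_proj S x - s) by rewrite addrA subrK.
rewrite [leRHS]sqr_hnormD orth_proj_orth ?mul0rn ?addr0; last first.
  exact: subspaceB (orth_proj_mem x) Ss.
by rewrite lerDl exprn_ge0 ?hnorm_ge0.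
Qed.

End Projection.

(** * The norm of a C*-algebra and the Neumann series *)

Section CstarNorm.
Variables (R : realType) (A : cstarAlgType R).
Implicit Types a b : A.

Lemma starD a b : star (a + b) = star a + star b.
Proof. by rewrite -[a]scale1r starDZ conjC1 !scale1r. Qed.

Lemma star1 : star (1 : A) = 1.
Proof. by rewrite -[LHS]mulr1 -[X in _ * X](@starK _ A) -starM mulr1 starK. Qed.

Lemma cnorm0 : cnorm (0 : A) = 0.
Proof. by rewrite -(scale0r (0 : A)) cnormZ normr0 mul0r. Qed.

Lemma cnormN a : cnorm (- a) = cnorm a.
Proof. by rewrite -scaleN1r cnormZ normrN1 mul1r. Qed.

Lemma cnorm_ge0 a : 0 <= cnorm a.
Proof.
by have := cnormD a (- a); rewrite subrr cnorm0 cnormN -mulr2n pmulrn_lge0.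
Qed.

Lemma cnorm1_le1 : cnorm (1 : A) <= 1.
Proof.
have := cnorm_starM (1 : A); rewrite star1 mulr1 => h.
have := cnorm_ge0 1; move: (cnorm 1) h => t h; rewrite expr2 -{1}[t]mulr1 in h.
by have [->|t0 _] := eqVneq t 0 => //; rewrite -(mulfI t0 h).
Qed.

Lemma cnormX_le a n : cnorm (a ^+ n) <= cnorm a ^+ n.
Proof.
elim: n => [|n IH]; first exact: cnorm1_le1.
by rewrite !exprS (le_trans (cnormM _ _)) // ler_wpM2l ?cnorm_ge0.
Qed.

(** The limit of the partial geometric sums. A left inverse is what bounds [|x|] by a multiple of
    [|(1 - a) x|] in a representation. *)
Lemma neumann_series a : cnorm a < 1 -> exists k : A, k * (1 - a) = 1.
Proof.
move=> a1; have a0 := cnorm_ge0 a; pose s n := \sum_(i < n) a ^+ i.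
have q0 : 0 < 1 - cnorm a by rewrite subr_gt0.
have small (e : R) : 0 < e -> exists N, forall n, (N <= n)%N -> cnorm a ^+ n < e.
  move=> e0; have /cvg_expr/cvgrPdist_lt/(_ _ e0)[N _ NP] : `|cnorm a| < 1.
    by rewrite ger0_norm.
  exists N => n Nn; have := NP _ Nn.
  by rewrite /= sub0r normrN ger0_norm ?exprn_ge0.
have sS n : s n.+1 = s n + a ^+ n by rewrite /s big_ord_recr.
(* The geometric tail estimate, multiplied out so that the induction on [j] telescopes. *)
have sD n j : cnorm (s (n + j)%N - s n) * (1 - cnorm a) <=
              cnorm a ^+ n - cnorm a ^+ (n + j).
  elim: j => [|j IH]; first by rewrite addn0 !subrr cnorm0 mul0r.
  rewrite addnS sS addrAC.
  have := ler_wpM2r (ltW q0) (le_trans (cnormD (s (n + j)%N - s n) (a ^+ (n + j)))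
    (lerD (lexx _) (cnormX_le a (n + j)))).
  rewrite exprSr mulrDl; move: IH; lra.
have [|k sk] := @cnorm_complete _ A s.
  move=> e e0; have e1 : 0 < e / 2 * (1 - cnorm a) by rewrite mulr_gt0 ?divr_gt0.
  have [N NP] := small _ e1; exists N.
  have sN n : (N <= n)%N -> cnorm (s n - s N) < e / 2.
    move=> /subnKC <-; rewrite -(ltr_pM2r q0).
    apply: (le_lt_trans (sD _ _)); apply: le_lt_trans (NP _ (leqnn N)).
    by rewrite gerBl exprn_ge0.
  move=> m n /sN sm /sN sn.
  have -> : s m - s n = (s m - s N) + - (s n - s N) by rewrite opprB addrA subrK.
  apply: (le_lt_trans (cnormD _ _)); rewrite cnormN; lra.
exists k; apply/eqP; rewrite -subr_eq0; apply/eqP; apply: cnorm_eq0.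
apply/eqP; rewrite eq_le cnorm_ge0 andbT; apply/ler_addgt0Pr => e e0.
rewrite add0r.
have c1 : 0 < cnorm (1 - a) + 1 by rewrite ltr_wpDl ?cnorm_ge0.
have [N NP] := sk (e / 2 / (cnorm (1 - a) + 1)) (divr_gt0 (divr_gt0 e0 (ltr0Sn _ 1)) c1).
have [N' NP'] := small (e / 2) (divr_gt0 e0 (ltr0Sn _ 1)).
set n := maxn N N'; move: (leq_maxl N N') (leq_maxr N N'); rewrite -/n => Nn Nn'.
(* Uses [s n * (1 - a) = 1 - a ^+ n]; both terms on the right become small. *)
have -> : k * (1 - a) - 1 = - ((s n - k) * (1 - a)) + - a ^+ n.
  have : s n * (1 - a) = 1 - a ^+ n.
    elim: (n) => [|i IH]; first by rewrite /s big_ord0 mul0r expr0 subrr.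
    by rewrite sS mulrDl IH mulrBr mulr1 -exprSr addrA subrK.
  by rewrite mulrBl => ->; rewrite opprB -addrA; congr (_ + _);
    rewrite opprB addrAC subrr add0r.
apply: (le_trans (cnormD _ _)); rewrite !cnormN.
have := NP' n Nn'; have := cnormX_le a n.
have := cnormM (s n - k) (1 - a); have := NP n Nn.
rewrite ltr_pdivlMr //.
have := cnorm_ge0 (s n - k); have := cnorm_ge0 (1 - a).
move: (cnorm (1 - a)) (cnorm (s n - k)) (cnorm (_ * _)) (cnorm (_ ^+ _)) => p q t u.
move: (_ ^+ _) => v; nra.
Qed.

End CstarNorm.

(** * Contractivity of representations of C*-algebras *)

Section Contractive.
Variables (R : realType) (A : cstarAlgType R) (H : hilbertType R).
Variables (pi : A -> H -> H) (pi_rep : star_rep pi).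

Lemma rep_bound a : exists2 C : R, 0 < C & forall x, hnorm (pi a x) <= C * hnorm x.
Proof.
have lin_pi := rep_op_linear pi_rep a.
pose f : {linear H -> H} := HB.pack (pi a) (GRing.isLinear.Build _ _ _ _ _ lin_pi).
have /linear_bounded_continuous/linear_boundedP/pinfty_ex_gt0[C C0 CP] :
  continuous f by exact: (rep_op_bounded pi_rep).
have {CP C0} [C' C0 CP] :
  exists2 C' : R, 0 < C' & forall x, `|f x| <= C'%:C%C * `|x|.
  case: C C0 CP => C b; rewrite ltcE /= => /andP[/eqP -> C0] CP.
  by exists C.
by exists C' => // x; have := CP x; rewrite !hnormE -rmorphM lecR.
Qed.

(* If [C] bounds the inverse of [1 - (pi h / M)^2], then
   [|x|^2 <= C^2 |x - (pi h / M)^2 x|^2 <= C^2 (|x|^2 - |pi h x|^2 / M^2)]. *)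
Lemma rep_bound_improve (h : A) (M : R) :
  star h = h -> cnorm h < M -> (forall x, hnorm (pi h x) <= M * hnorm x) ->
  exists2 M' : R, 0 <= M' < M & forall x, hnorm (pi h x) <= M' * hnorm x.
Proof.
move=> hh hM piM; have M0 : 0 < M := le_lt_trans (cnorm_ge0 h) hM.
pose g := (M ^- 2)%:C%C *: (h * h).
have g1 : cnorm g < 1.
  rewrite /g cnormZ re_norm_real ger0_norm ?invr_ge0 ?exprn_ge0 ?ltW //.
  rewrite mulrC ltr_pdivrMr ?exprn_gt0 // mul1r -{1}hh cnorm_starM.
  by rewrite ltr_pXn2r ?nnegrE ?cnorm_ge0 ?ltW.
have [k kg] := neumann_series g1; have [C C0 piC] := rep_bound k.
have sq x : hnorm x ^+ 2 <= C ^+ 2 * (hnorm x ^+ 2 - hnorm (pi h x) ^+ 2 / M ^+ 2).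
  set T := pi h x.
  have gx : pi (1 - g) x = x - (M ^- 2)%:C%C *: pi h T.
    have -> : 1 - g = (-1) *: g + 1 by rewrite scaleN1r addrC.
    rewrite (rep_linear pi_rep) rep_one // /g -[_ *: (h * h)]addr0.
    rewrite (rep_linear pi_rep) (rep_mul pi_rep).
    have -> : pi 0 x = 0.
      have := rep_linear pi_rep (-1) 0 0 x.
      by rewrite scaleN1r oppr0 addr0 scaleN1r addNr.
    by rewrite addr0 scaleN1r addrC.
  have xk : x = pi k (pi (1 - g) x) by rewrite -(rep_mul pi_rep) kg rep_one.
  have : hnorm x ^+ 2 <= C ^+ 2 * hnorm (pi (1 - g) x) ^+ 2.
    rewrite -exprMn ler_sqr ?nnegrE ?mulr_ge0 ?hnorm_ge0 ?(ltW C0) //.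
    by rewrite [leLHS](congr1 (@hnorm _ _) xk) piC.
  move/le_trans; apply; rewrite ler_wpM2l ?exprn_ge0 ?(ltW C0) // gx sqr_hnormB.
  rewrite dotZr hnormZr exprMn real_normK ?num_real //.
  have -> : dot x (pi h T) = dot T T by rewrite -{1}hh -(rep_star pi_rep).
  have -> : (M ^- 2)%:C%C^* = (M ^- 2)%:C%C :> R[i].
    by apply/CrealP; rewrite complex_real.
  have -> : complex.Re ((M ^- 2)%:C%C * dot T T) = M ^- 2 * hnorm T ^+ 2.
    by rewrite -re_dotxx; case: (dot T T) => a b /=; rewrite mul0r subr0.
  (* The assumed bound, applied to [T], lets the quartic term absorb one of the two copies of
     [|T|^2 / M^2] in the expanded square. *)
  have : M ^- 2 ^+ 2 * hnorm (pi h T) ^+ 2 <= M ^- 2 ^+ 2 * (M * hnorm T) ^+ 2.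
    rewrite ler_wpM2l ?exprn_ge0 ?invr_ge0 ?exprn_ge0 ?(ltW M0) //.
    by rewrite ler_sqr ?nnegrE ?mulr_ge0 ?hnorm_ge0 ?(ltW M0).
  have -> : (M ^- 2) ^+ 2 * (M * hnorm T) ^+ 2 = hnorm T ^+ 2 / M ^+ 2.
    by field; rewrite gt_eqF.
  rewrite (mulrC (M ^- 2) (hnorm T ^+ 2)) mulr2n; lra.
(* Solves [sq] for [|pi h x|]. If [1 - C ^- 2] is negative, the root is 0 by default and the bound
   still holds. *)
exists (M * Num.sqrt (1 - C ^- 2)) => [|x].
  rewrite mulr_ge0 ?sqrtr_ge0 ?ltW //= -[ltRHS]mulr1 ltr_pM2l //.
  by rewrite -[ltRHS]sqrtr1 ltr_sqrt // gtrBl invr_gt0 exprn_gt0.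
rewrite -ler_sqr ?nnegrE ?mulr_ge0 ?hnorm_ge0 ?sqrtr_ge0 ?(ltW M0) // !exprMn.
apply: (@le_trans _ _ (M ^+ 2 * (1 - C ^- 2) * hnorm x ^+ 2)); last first.
  rewrite ler_wpM2r ?exprn_ge0 ?hnorm_ge0 // ler_wpM2l ?exprn_ge0 ?(ltW M0) //.
  have [s0|s0] := leP 0 (1 - C ^- 2); first by rewrite sqr_sqrtr.
  by rewrite (le_trans (ltW s0)) // exprn_ge0 ?sqrtr_ge0.
have := sq x; rewrite mulrC -ler_pdivrMr ?exprn_gt0 // -(ler_pM2l (exprn_gt0 2 M0)).
have -> : M ^+ 2 * (hnorm x ^+ 2 - hnorm (pi h x) ^+ 2 / M ^+ 2) =
          M ^+ 2 * hnorm x ^+ 2 - hnorm (pi h x) ^+ 2.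
  by field; rewrite gt_eqF.
have -> : M ^+ 2 * (1 - C ^- 2) * hnorm x ^+ 2 =
          M ^+ 2 * hnorm x ^+ 2 - M ^+ 2 * (hnorm x ^+ 2 / C ^+ 2).
  by field; rewrite gt_eqF.
lra.
Qed.

(** The infimum of all bounds of [pi h] is itself a bound. Were it above [cnorm h], it could be
    improved, contradicting minimality; no spectral theory is involved. *)
Lemma rep_selfadjoint_contractive (h : A) :
  star h = h -> forall x, hnorm (pi h x) <= cnorm h * hnorm x.
Proof.
move=> hh.
pose E := [set M : R | 0 <= M /\ forall x, hnorm (pi h x) <= M * hnorm x].
have infE : has_inf E.
  have [C C0 CP] := rep_bound h; split; first by exists C; split=> //; apply: ltW.
  by exists 0 => M [].
have infP x : hnorm (pi h x) <= inf E * hnorm x.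
  apply/ler_addgt0Pr => e e0.
  have x1 : 0 < hnorm x + 1 by rewrite ltr_wpDl ?hnorm_ge0.
  have [M [_ MP] ME] := inf_adherent (divr_gt0 e0 x1) infE.
  apply: (le_trans (MP x)).
  apply: (le_trans (ler_wpM2r (hnorm_ge0 x) (ltW ME))).
  rewrite mulrDl lerD2l -mulrA ger_pMr // mulrC ler_pdivrMr // mul1r lerDl.
  exact: ler01.
move=> x; have [hE|hE] := leP (inf E) (cnorm h).
  by rewrite (le_trans (infP x)) // ler_wpM2r ?hnorm_ge0.
have [M /andP[M0 ME] MP] := rep_bound_improve hh hE infP.
by have := ge_inf infE.2 (conj M0 MP); rewrite leNgt ME.
Qed.

(** The C*-identity reduces this to the self-adjoint element [star a * a], as
    [|pi a x|^2 = <x, pi (star a * a) x>]. *)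
Lemma rep_contractive (a : A) x : hnorm (pi a x) <= cnorm a * hnorm x.
Proof.
rewrite -ler_sqr ?nnegrE ?mulr_ge0 ?hnorm_ge0 ?cnorm_ge0 //.
rewrite -re_dotxx (rep_star pi_rep) -(rep_mul pi_rep) exprMn -cnorm_starM.
apply: (le_trans (re_dot_le _ _)); rewrite mulrC expr2 mulrA ler_wpM2r ?hnorm_ge0 //.
by apply: rep_selfadjoint_contractive; rewrite starM starK.
Qed.

End Contractive.

(** * A closed subspace as a Hilbert space *)

Section SubspaceHilbert.
Variables (R : realType) (H : hilbertType R) (S : set H).
Hypothesis S_sub : closed_subspace S.

(* The proof is an argument because the Hilbert space structure of
   [subspace_type] is inferred from it. *)
Definition in_subspace of closed_subspace S : {pred H} := [pred x | `[< S x >]].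
Local Notation P := (in_subspace S_sub).

Lemma in_subspaceP x : reflect (S x) (x \in P).
Proof. exact: asboolP. Qed.

Lemma in_subspace_submod : GRing.submod_closed P.
Proof.
split; first by apply/in_subspaceP; exact: subspace0.
move=> c x y /in_subspaceP Sx /in_subspaceP Sy; apply/in_subspaceP.
exact: subspaceDZ.
Qed.

HB.instance Definition _ := GRing.isSubmodClosed.Build R[i] H P in_subspace_submod.

(** Property (T) quantifies over Hilbert spaces as types, so a subspace must become one before it
    can carry a representation. *)
Definition subspace_type := {x : H | x \in P}.
HB.instance Definition _ := SubType.on subspace_type.
HB.instance Definition _ := [Choice of subspace_type by <:].
HB.instance Definition _ := [SubChoice_isSubLmodule of subspace_type by <:].
Local Notation K := subspace_type.

Let knorm (x : K) : R[i] := `|\val x|.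
Let knormD x y : knorm (x + y) <= knorm x + knorm y.
Proof. by rewrite /knorm raddfD ler_normD. Qed.
Let knormZ (c : R[i]) x : knorm (c *: x) = `|c| * knorm x.
Proof. by rewrite /knorm linearZ normrZ. Qed.
Let knorm_eq0 x : knorm x = 0 -> x = 0.
Proof. by move/eqP; rewrite normr_eq0 => /eqP x0; apply: val_inj; rewrite x0 raddf0. Qed.
HB.instance Definition _ := Lmodule_isNormed.Build R[i] K knormD knormZ knorm_eq0.

Lemma subspace_ballE (x y : K) e : ball x e y = ball (\val x) e (\val y).
Proof. by rewrite -!ball_normE /= /Num.norm /= /knorm raddfB. Qed.

(** The inclusion is isometric, so the image filter is Cauchy and converges in [H]; closedness puts
    the limit in [S]. *)
Let kcomplete (F : set_system K) : ProperFilter F -> cauchy F -> cvg F.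
Proof.
move=> FF /cauchy_ballP FC.
have /cvg_ex[l Fl] : cvg ((\val : K -> H) @ F).
  apply: cauchy_cvg; apply/cauchy_ballP => e e0.
  have [[U V] /= [FU FV] UV] := FC e e0.
  exists (\val @` U, \val @` V) => /=.
    by split; [apply: filterS FU|apply: filterS FV] => z Uz; exists z.
  by move=> [_ _] /= [[z Uz <-] [w Vw <-]];
    have := UV (z, w) (conj Uz Vw); rewrite /= subspace_ballE.
have Sl : S l.
  apply: (subspace_closed S_sub) => e e0.
  have e0' : 0 < e%:C%C by rewrite ltcR.
  have /cvgrPdist_lt /(_ _ e0') /filter_ex [z /=] := Fl.
  rewrite hnormE ltcR => ze; exists (\val z) => //.
  by apply/in_subspaceP; exact: (valP z).
apply/cvg_ex; exists (Sub l (introT (in_subspaceP l) Sl) : K).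
apply/cvg_ballP => e e0; have /cvg_ballP /(_ _ e0) := Fl.
by apply: filterS => z /=; rewrite subspace_ballE SubK.
Qed.
HB.instance Definition _ := Uniform_isComplete.Build K kcomplete.

Let kdot (x y : K) : R[i] := dot (\val x) (\val y).
Let kdotDZl (c : R[i]) x y z : kdot (c *: x + y) z = c * kdot x z + kdot y z.
Proof. by rewrite /kdot linearP dotDZl. Qed.
Let kdotC x y : kdot y x = (kdot x y)^*.
Proof. exact: dotC. Qed.
Let kdotxx (x : K) : kdot x x = `|x| ^+ 2.
Proof. exact: dotxx. Qed.
HB.instance Definition _ := isHilbert.Build R K kdotDZl kdotC kdotxx.

Lemma subspace_dotE (x y : K) : dot x y = dot (\val x) (\val y).
Proof. by []. Qed.

Lemma subspace_hnormE (x : K) : hnorm x = hnorm (\val x).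
Proof. by []. Qed.

End SubspaceHilbert.

(** * Unitary representations, fixed vectors and property (T) *)

Section UnitaryReps.
Variables (R : realType) (G : groupType) (H : hilbertType R) (U : G -> H -> H).
Hypothesis U_rep : unitary_rep U.
Variables (S : set H) (S_sub : closed_subspace S).
Hypothesis S_inv : forall t x, S x -> S (U t x).

Definition fixed_vectors : set H := [set x | S x /\ forall t, U t x = x].

Lemma urep_hnorm t x : hnorm (U t x) = hnorm x.
Proof. by apply: hnorm_eq_from_dot; apply: (urep_dot U_rep). Qed.

Lemma urepB t x y : U t (x - y) = U t x - U t y.
Proof.
by rewrite addrC -scaleN1r (urep_linear U_rep) scaleN1r addrC.
Qed.

Lemma urep0 t : U t 0 = 0.
Proof. by have := urepB t 0 0; rewrite !subrr. Qed.

Lemma urepZ t c x : U t (c *: x) = c *: U t x.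
Proof.
by rewrite -[c *: x]addr0 (urep_linear U_rep) urep0 addr0.
Qed.

Lemma urep_dotV t x y : dot (U t x) y = dot x (U t^-1%g y).
Proof. by rewrite -[in RHS](urep_dot U_rep t) -(urep_mul U_rep) mulgV urep_one. Qed.

Lemma fixed_vectors_closed : closed_subspace fixed_vectors.
Proof.
split.
- by split=> [|t]; [exact: (subspace0 S_sub)|exact: urep0].
- move=> c x y [Sx Ux] [Sy Uy]; split; first exact: (subspaceDZ S_sub).
  by move=> t; rewrite (urep_linear U_rep) Ux Uy.
move=> x xcl; split.
  by apply: (subspace_closed S_sub) => e /xcl[y [Sy _] xy]; exists y.
move=> t; apply/eqP; rewrite -subr_eq0 -hnorm_eq0 eq_le hnorm_ge0 andbT.
apply/ler_addgt0Pr => e e0; have [y [_ Uy] xy] := xcl (e / 2) (divr_gt0 e0 (ltr0Sn _ 1)).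
have := hdistD (U t y) (U t x) x; rewrite -urepB urep_hnorm Uy (hdistC y) add0r; lra.
Qed.

Lemma orth_complement_closed (F : set H) :
  closed_subspace [set x | S x /\ forall y, F y -> dot x y = 0].
Proof.
split.
- by split=> [|y _]; [exact: (subspace0 S_sub)|rewrite dot0l].
- move=> c x y [Sx Fx] [Sy Fy]; split; first exact: (subspaceDZ S_sub).
  by move=> z Fz; rewrite dotDZl Fx // Fy // mulr0 addr0.
move=> x xcl; split.
  by apply: (subspace_closed S_sub) => e /xcl[y [Sy _] xy]; exists y.
move=> z Fz.
have dot_re c : complex.Re (dot x (c *: z)) <= 0.
  apply/ler_addgt0Pr => e e0; have z1 : 0 < hnorm (c *: z) + 1.
    by rewrite ltr_wpDl ?hnorm_ge0.
  have [y [_ Fy] xy] := xcl _ (divr_gt0 e0 z1).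
  have -> : dot x (c *: z) = dot (x - y) (c *: z).
    by rewrite dotBl [dot y _]dotZr Fy // mulr0 subr0.
  rewrite add0r (le_trans (re_dot_le _ _)) //.
  rewrite (le_trans (ler_wpM2r (hnorm_ge0 _) (ltW xy))) // -mulrA ger_pMr //.
  by rewrite mulrC ler_pdivrMr // mul1r lerDl ler01.
(* The four units bound the real and imaginary parts of [dot x z] by 0 from both sides. *)
have := dot_re 1; have := dot_re (-1); have := dot_re 'i%C; have := dot_re (- 'i%C).
rewrite !dotZr; case: (dot x z) => a b; rewrite /= => h1 h2 h3 h4.
by apply/eqP; rewrite eq_complex /=; apply/andP; split; apply/eqP; lra.
Qed.

End UnitaryReps.

(** Makes property (T) quantitative: a vector far from the fixed vectors but little displaced would,
    after projection and normalization, be almost invariant in a representation without nonzero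
    fixed vectors. *)
Lemma kazhdan_displacement (R : realType) (G : groupType) :
  property_T R G ->
  exists (F : set G) (e : R), [/\ finite_set F, F !=set0, 0 < e &
    forall (H : hilbertType R) (U : G -> H -> H) (S : set H),
      unitary_rep U -> closed_subspace S -> (forall t x, S x -> S (U t x)) ->
      forall (d : R) x, S x -> (forall t, F t -> hnorm (U t x - x) < d) ->
      e * hnorm (x - orth_proj (fixed_vectors U S) x) < d].
Proof.
move=> [F [e [finF F0 e0 FT]]]; exists F, e; split=> // H U S U_rep S_sub S_inv d x Sx xd.
have fix_sub := fixed_vectors_closed U_rep S_sub.
set p := orth_proj _ x; have [Sp Up] : fixed_vectors U S p := orth_proj_mem fix_sub x.
set y := x - p; have [y0|y0] := eqVneq y 0.
  (* Here the claim is [0 < d], which a displacement at any element of the nonempty [F] provides. *)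
  case: F0 => t Ft; rewrite y0 hnorm0 mulr0.
  exact: le_lt_trans (hnorm_ge0 _) (xd _ Ft).
have Uy t : U t y - y = U t x - x.
  by rewrite urepB // Up /y opprB addrA subrK.
rewrite ltNge; apply/negP => dle.
pose W := [set z | S z /\ forall w, fixed_vectors U S w -> dot z w = 0].
have W_sub : closed_subspace W := orth_complement_closed S_sub _.
have WU t z : W z -> W (U t z).
  case=> Sz Wz; split; first exact: S_inv.
  by move=> w Fw; rewrite urep_dotV // Fw.2 Wz.
have Wy : W y.
  split; first exact: subspaceB.
  by move=> w; apply: orth_proj_orth.
pose K := subspace_type W_sub : hilbertType R.
have inW (z : K) : W (\val z) by apply/(in_subspaceP W_sub); exact: (valP z).
pose sub z (Wz : W z) : K := Sub z (introT (in_subspaceP W_sub z) Wz).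
pose V t (z : K) : K := sub _ (WU t _ (inW z)).
have V_rep : unitary_rep V.
  split.
  - by move=> t c z w; apply: val_inj; rewrite /= (urep_linear U_rep).
  - by move=> s t z; apply: val_inj; rewrite /= (urep_mul U_rep).
  - by move=> z; apply: val_inj; rewrite /= (urep_one U_rep).
  - by move=> t z w; rewrite !subspace_dotE /= (urep_dot U_rep).
have [|z [z0 Vz]] := FT K V V_rep.
  (* Since [p] is fixed, [y] is displaced exactly as [x] is; after normalization the displacement is
     below [d / |y| <= e]. *)
  exists (sub _ (subspaceZ W_sub (hnorm y)^-1%:C%C Wy)); split.
    by rewrite subspace_hnormE hnorm_normalize.
  move=> t Ft; rewrite subspace_hnormE raddfB /= urepZ // -scalerBr Uy.
  rewrite hnormZr ger0_norm ?invr_ge0 ?hnorm_ge0 // mulrC ltr_pdivrMr.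
    exact: lt_le_trans (xd _ Ft) dle.
  by rewrite lt_def hnorm_eq0 y0 hnorm_ge0.
(* The invariant vector [z] is fixed and orthogonal to all fixed vectors, hence to itself. *)
have Fz : fixed_vectors U S (\val z).
  split; first by case: (inW z).
  by move=> t; rewrite -[in RHS](Vz t).
have [_ /(_ _ Fz)/dotxx_eq0 z00] := inW z.
by case/eqP: z0; apply: val_inj; rewrite z00 raddf0.
Qed.

(** * Algebra of representations and their restriction along homomorphisms *)

Section StarReps.
Variables (R : realType) (A : cstarAlgType R) (H : hilbertType R).
Variables (pi : A -> H -> H) (pi_rep : star_rep pi).

Lemma repD a b x : pi (a + b) x = pi a x + pi b x.
Proof. by rewrite -[a]scale1r (rep_linear pi_rep) !scale1r. Qed.

Lemma rep0 x : pi 0 x = 0.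
Proof. by have := repD 0 0 x; rewrite addr0 -{1}[pi 0 x]addr0 => /addrI. Qed.

Lemma repN a x : pi (- a) x = - pi a x.
Proof. by apply/eqP; rewrite -addr_eq0 -repD addNr rep0. Qed.

Lemma repB a b x : pi (a - b) x = pi a x - pi b x.
Proof. by rewrite repD repN. Qed.

Lemma rep_sum (I : Type) (r : seq I) (F : I -> A) x :
  pi (\sum_(i <- r) F i) x = \sum_(i <- r) pi (F i) x.
Proof.
by elim/big_rec2: _ => [|i y a _ IH]; rewrite ?rep0 // repD IH.
Qed.

Lemma rep_opB a x y : pi a (x - y) = pi a x - pi a y.
Proof. by rewrite addrC -scaleN1r (rep_op_linear pi_rep) scaleN1r addrC. Qed.

Lemma rep_opZ a c x : pi a (c *: x) = c *: pi a x.
Proof.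
have pi0 : pi a 0 = 0 by have := rep_opB a 0 0; rewrite !subrr.
by rewrite -[c *: x]addr0 (rep_op_linear pi_rep) pi0 addr0.
Qed.

End StarReps.

Lemma star_rep_comp (R : realType) (A B : cstarAlgType R) (f : B -> A)
    (H : hilbertType R) (pi : A -> H -> H) :
  unital_star_hom f -> star_rep pi -> star_rep (pi \o f).
Proof.
move=> f_hom pi_rep; split=> /=.
- by move=> a; apply: (rep_op_linear pi_rep).
- by move=> a; apply: (rep_op_bounded pi_rep).
- by move=> c a b x; rewrite (star_hom_linear f_hom) (rep_linear pi_rep).
- by move=> a b x; rewrite (star_hom_mul f_hom) (rep_mul pi_rep).
- by move=> x; rewrite (star_hom_one f_hom) (rep_one pi_rep).
- by move=> a x y; rewrite (rep_star pi_rep) (star_hom_star f_hom).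
Qed.

Lemma star_hom_opp (R : realType) (A B : cstarAlgType R) (f : B -> A) :
  unital_star_hom f -> @unital_star_hom R B^c A^c f.
Proof.
move=> f_hom; split.
- exact: (star_hom_linear f_hom).
- by move=> x y; apply: (star_hom_mul f_hom).
- exact: (star_hom_one f_hom).
- exact: (star_hom_star f_hom).
Qed.

(** * Hilbert bimodules and central vectors *)

Section Bimodule.
Variables (R : realType) (A : cstarAlgType R) (H : hilbertType R).
Variables (l : A -> H -> H) (r : H -> A -> H).
Hypothesis lr : hilbert_bimodule l r.

Let l_rep : star_rep l. Proof. by case: lr. Qed.
Let r_rep : @star_rep R A^c H (fun b x => r x b). Proof. by case: lr. Qed.

Lemma bimodC a b x : l a (r x b) = r (l a x) b.
Proof. by case: lr => _ _; apply. Qed.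

Lemma bimod_rM x a b : r x (a * b) = r (r x a) b.
Proof. exact: (rep_mul r_rep b a x). Qed.

Definition comm_op (a : A) (x : H) : H := l a x - r x a.

Lemma comm_opB a x y : comm_op a (x - y) = comm_op a x - comm_op a y.
Proof.
rewrite /comm_op (rep_opB l_rep) (rep_opB r_rep) !opprD !opprK addrACA.
by congr (_ + _); rewrite addrC.
Qed.

Lemma comm_opZ a c x : comm_op a (c *: x) = c *: comm_op a x.
Proof. by rewrite /comm_op (rep_opZ l_rep) (rep_opZ r_rep) scalerBr. Qed.

Lemma comm_op_le a x : hnorm (comm_op a x) <= cnorm a * hnorm x *+ 2.
Proof.
rewrite (le_trans (ler_hnormD _ _)) // hnorm_opp mulr2n lerD //.
  exact: rep_contractive.
exact: (rep_contractive r_rep).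
Qed.

(** It is the common kernel of the bounded linear operators [comm_op b]. *)
Lemma central_closed (B : set A) : closed_subspace (central l r B).
Proof.
have centralE : central l r B = [set x | forall b, B b -> comm_op b x = 0].
  apply/seteqP; split=> x xB b Bb; first by rewrite /comm_op xB // subrr.
  by apply/eqP; rewrite -subr_eq0; apply/eqP; apply: xB.
rewrite centralE; split.
- by move=> b _; have := comm_opB b 0 0; rewrite !subrr.
- move=> c x y xB yB b Bb; rewrite -[y]opprK comm_opB comm_opZ xB // scaler0.
  by rewrite -[- y]scaleN1r comm_opZ yB // scaler0 subrr.
move=> x xcl b Bb; apply/eqP; rewrite -hnorm_eq0 eq_le hnorm_ge0 andbT.
apply/ler_addgt0Pr => e e0; rewrite add0r.
have c1 : 0 < cnorm b *+ 2 + 1 by rewrite ltr_wpDl // mulrn_wge0 // cnorm_ge0.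
have [y yB xy] := xcl _ (divr_gt0 e0 c1).
have -> : comm_op b x = comm_op b (x - y) by rewrite comm_opB yB // subr0.
rewrite (le_trans (comm_op_le _ _)) // -mulrnAl mulrC.
rewrite (le_trans (ler_wpM2r _ (ltW xy))) // ?mulrn_wge0 ?cnorm_ge0 //.
by rewrite mulrAC ler_pdivrMr // ler_pM2l // lerDl ler01.
Qed.

(** Contractivity of both actions makes [comm_op a x] norm-continuous in [a]. *)
Lemma central_dense (D : set A) x :
  (forall (a : A) (e : R), 0 < e -> exists2 b, D b & cnorm (a - b) < e) ->
  central l r D x -> central l r setT x.
Proof.
move=> D_dense xD a _; apply/eqP; rewrite -subr_eq0 -hnorm_eq0 eq_le hnorm_ge0 andbT.
apply/ler_addgt0Pr => e e0; rewrite add0r -/(comm_op a x).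
have c1 : 0 < hnorm x *+ 2 + 1 by rewrite ltr_wpDl // mulrn_wge0 // hnorm_ge0.
have [b Db ab] := D_dense a _ (divr_gt0 e0 c1).
have -> : comm_op a x = comm_op (a - b) x.
  have rB : r x (a - b) = r x a - r x b := repB r_rep a b x.
  by rewrite /comm_op (repB l_rep) rB (xD b Db) opprB addrA subrK.
rewrite (le_trans (comm_op_le _ _)) // -mulrnAr.
rewrite (le_trans (ler_wpM2r _ (ltW ab))) // ?mulrn_wge0 ?hnorm_ge0 //.
by rewrite mulrAC ler_pdivrMr // ler_pM2l // lerDl ler01.
Qed.

Lemma bimodule_comp (B : cstarAlgType R) (f : B -> A) : unital_star_hom f ->
  hilbert_bimodule (l \o f) (fun x b => r x (f b)).
Proof.
move=> f_hom; split; first exact: star_rep_comp.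
  exact: (star_rep_comp (star_hom_opp f_hom) r_rep).
by move=> a b x /=; apply: bimodC.
Qed.

End Bimodule.

(** * The conjugation representation of the group on a bimodule *)

Section Conjugation.
Variables (R : realType) (G : groupType) (B : cstarAlgType R) (act : G -> B -> B).
Variables (A : cstarAlgType R) (iota : B -> A) (u : G -> A).
Hypothesis pair : covariant_pair act iota u.
Variables (H : hilbertType R) (l : A -> H -> H) (r : H -> A -> H).
Hypothesis lr : hilbert_bimodule l r.

Let l_rep : star_rep l. Proof. by case: lr. Qed.
Let r_rep : @star_rep R A^c H (fun b x => r x b). Proof. by case: lr. Qed.

Definition conj_rep (t : G) (x : H) : H := l (u t) (r x (u t^-1%g)).

Lemma pair_mulgV t : u t * u t^-1%g = 1.
Proof. by rewrite -(pair_mul pair) mulgV (pair_one pair). Qed.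

Lemma pair_mulVg t : u t^-1%g * u t = 1.
Proof. by rewrite -(pair_mul pair) mulVg (pair_one pair). Qed.

Lemma conj_rep_unitary : unitary_rep conj_rep.
Proof.
split.
- move=> t c x y; rewrite /conj_rep (rep_op_linear r_rep).
  exact: (rep_op_linear l_rep).
- move=> s t x; rewrite /conj_rep (pair_mul pair) invgM (pair_mul pair).
  by rewrite (rep_mul l_rep) (bimod_rM lr) -!(bimodC lr).
- move=> x; rewrite /conj_rep invg1 (pair_one pair) (rep_one l_rep).
  exact: (rep_one r_rep).
move=> t x y; rewrite /conj_rep (rep_star l_rep) (pair_star pair).
rewrite -(rep_mul l_rep) pair_mulVg (rep_one l_rep) (rep_star r_rep).
have -> : @star R A^c (u t^-1%g) = u t 
  by have := pair_star pair t^-1%g; rewrite invgK.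
by rewrite -(bimod_rM lr) pair_mulVg (rep_one r_rep).
Qed.

(** Factoring out the right action of a unitary, which is isometric, identifies the displacement
    with the norm of the commutator. *)
Lemma conj_repB t x : conj_rep t x - x = r (comm_op l r (u t) x) (u t^-1%g).
Proof.
rewrite /comm_op (rep_opB r_rep) -(bimod_rM lr) pair_mulgV (rep_one r_rep).
by rewrite -(bimodC lr).
Qed.

Lemma hnorm_r_unitary t x : hnorm (r x (u t)) = hnorm x.
Proof.
move: x; apply: hnorm_eq_from_dot => x y; rewrite (rep_star r_rep).
by rewrite [star _](pair_star pair) -(bimod_rM lr) pair_mulgV (rep_one r_rep).
Qed.

Lemma conj_rep_displacement t x :
  hnorm (conj_rep t x - x) = hnorm (l (u t) x - r x (u t)).
Proof. by rewrite conj_repB hnorm_r_unitary. Qed.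

Lemma conj_rep_central t x :
  star_action act ->
  central l r (range iota) x -> central l r (range iota) (conj_rep t x).
Proof.
move=> act_ok xB _ [b _ <-]; rewrite /conj_rep.
have cov s c : u s * iota c = iota (act s c) * u s.
  rewrite -(pair_cov pair) -mulrA (pair_star pair) pair_mulVg mulr1; congr (_ * _).
(* With [c = act t^-1 b], covariance moves [b] past [u t] as [c]; there [c] commutes with [x], and
   covariance for [t^-1] turns it back into [b] on the right. *)
have -> : b = act t (act t^-1%g b).
  by rewrite -(action_mul act_ok) mulgV (action_one act_ok).
set c := act t^-1%g b.
rewrite -(rep_mul l_rep) -cov (rep_mul l_rep) (bimodC lr) xB; last by exists c.
rewrite -(bimodC lr) -!(bimod_rM lr); congr (l _ (r _ _)).
by rewrite cov -(action_mul act_ok) mulVg (action_one act_ok).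
Qed.

Lemma conj_rep_fixed_central :
  fixed_vectors conj_rep (central l r (range iota)) = central l r setT.
Proof.
apply/seteqP; split=> x; last first.
  move=> xA; split=> [b _|t]; first exact: xA.
  apply/eqP; rewrite -subr_eq0 -hnorm_eq0 conj_rep_displacement.
  by rewrite xA // subrr hnorm0.
case=> xB xU.
have xu t : l (u t) x = r x (u t).
  apply/eqP; rewrite -subr_eq0 -hnorm_eq0 -conj_rep_displacement.
  by rewrite xU subrr hnorm0.
(* The image of [C_c(G, B)], dense in [A]. Each term [iota (f t) * u t] commutes with [x] because
   both factors do. *)
pose D := [set cross_sum iota u p.1 p.2 | p in [set: {fset G} * (G -> B)]].
apply: (@central_dense _ _ _ _ _ lr D).
  move=> a e /(pair_dense pair a)[F [f Ff]].
  by exists (cross_sum iota u F f) => //; exists (F, f).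
move=> _ [[F f] _ <-]; rewrite /cross_sum /= (rep_sum l_rep) (rep_sum r_rep).
apply: eq_bigr => t _; rewrite (rep_mul l_rep) xu (bimodC lr) xB; last by exists (f t).
by rewrite -(bimod_rM lr).
Qed.

End Conjugation.

(** * Co-rigidity and strong property (T) of crossed products *)

Lemma crossed_product_corigid (R : realType) (G : groupType) (B : cstarAlgType R)
    (act : G -> B -> B) (A : cstarAlgType R) (iota : B -> A) (u : G -> A) :
  star_action act -> covariant_pair act iota u -> property_T R G ->
  strongly_corigid (range iota).
Proof.
move=> act_ok pair /kazhdan_displacement[F [e [finF [t0 Ft0] e0 FT]]] c c0.
(* Commutators with [u t] below [e * c] are displacements below [e * c], so the displacement
   estimate yields a distance below [c]. *)
exists (u @` F), (e * c); split.
- exact: finite_image.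
- by exists (u t0), t0.
- exact: mulr_gt0.
move=> H l r lr x [[_ xQ] xB].
rewrite -(ltr_pM2l e0) -(conj_rep_fixed_central pair lr).
apply: FT => //.
- exact: (conj_rep_unitary pair lr).
- exact: (central_closed lr).
- by move=> t y; apply: (conj_rep_central pair lr).
by move=> t Ft; rewrite (conj_rep_displacement pair lr) xQ //; exists t.
Qed.

Lemma finite_cnorm_bound (R : realType) (A : cstarAlgType R) (Q : set A) :
  finite_set Q -> exists2 M : R, 0 <= M & forall a, Q a -> cnorm a <= M.
Proof.
move=> /finite_seqP[s ->]; exists (\sum_(a <- s) cnorm a).
  by apply: sumr_ge0 => a _; apply: cnorm_ge0.
move=> a /= sa; rewrite (big_rem a) //= lerDl.
by apply: sumr_ge0 => b _; apply: cnorm_ge0.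
Qed.

(* The vector is projected to [H^B] by strong property (T) of [B], normalized,
   and then projected to [H^A] by co-rigidity. *)
Lemma strong_property_T_corigid (R : realType) (A B : cstarAlgType R)
    (iota : B -> A) :
  unital_star_hom iota -> strong_property_T B -> strongly_corigid (range iota) ->
  strong_property_T A.
Proof.
move=> iota_hom BT AB a a0.
have [Q [d [finQ _ d0 QP]]] := AB (a / 2) (divr_gt0 a0 (ltr0Sn _ 1)).
have [M M0 MP] := finite_cnorm_bound finQ.
have M1 : 0 < M + 1 by rewrite ltr_wpDl.
(* It will turn out that [|x - z| < 2 a']. The first bound makes this at most [a / 2]; the second
   keeps [y] nonzero; the third keeps the commutators of [x - z] with [Q] at most [4 M a' <= d / 2].
   Adding 1 avoids dividing by 0. *)
pose a' := Num.min (Num.min (a / 4) 2^-1) (d / 8 / (M + 1)).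
have a'0 : 0 < a' by rewrite !lt_min invr_gt0 ltr0Sn !divr_gt0.
have [a'a a'1 a'd] : [/\ a' <= a / 4, a' <= 2^-1 & a' <= d / 8 / (M + 1)].
  by split; rewrite /a' !ge_min lexx ?orbT.
have [Q' [b [finQ' [q0 Qq0] b0 Q'P]]] := BT a' a'0.
exists (Q `|` iota @` Q'), (Num.min b (d / 2)); split.
- by rewrite finite_setU; split => //; apply: finite_image.
- by exists (iota q0); right; exists q0.
- by rewrite lt_min b0 divr_gt0.
move=> H l r lr x [x1 xQ].
have lrB := bimodule_comp lr iota_hom.
(* Restricting the actions along [iota] makes [H] a bimodule over [B], so strong property (T) of [B]
   controls the projection to [H^B]. *)
have centralB : central (l \o iota) (fun x b => r x (iota b)) setT =
                central l r (range iota).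
  apply/seteqP; split=> y yB; first by move=> _ [c _ <-]; apply: (yB c).
  by move=> c _; apply: yB; exists c.
have B_sub := central_closed lr (range iota).
have A_sub := central_closed lr setT.
have xy := Q'P H _ _ lrB x; rewrite centralB in xy.
set y := orth_proj _ x in xy.
have {}xy : hnorm (x - y) < a'.
  apply: xy; split=> // c Qc.
  have /xQ : (Q `|` iota @` Q') (iota c) by right; exists c.
  by rewrite lt_min => /andP[].
have yB : central l r (range iota) y := orth_proj_mem B_sub x.
have y0 : 1 - a' < hnorm y.
  have := ler_hnormD (x - y) y; rewrite subrK x1; lra.
have y0' : y != 0 by rewrite -hnorm_eq0 gt_eqF //; lra.
have y1 : hnorm y < 1 + a'.
  have := ler_hnormD (y - x) x; rewrite subrK x1 hdistC; lra.
pose z := (hnorm y)^-1%:C%C *: y.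
have zB : central l r (range iota) z := subspaceZ B_sub _ yB.
have z1 : hnorm z = 1 by apply: hnorm_normalize.
have yz : hnorm (y - z) < a'.
  (* Hence [|y - z|] is the distance of [|y|] to 1, which is below [a']. *)
  have -> : y - z = (1 - (hnorm y)^-1)%:C%C *: y.
    by rewrite rmorphB scalerBl scale1r.
  rewrite hnormZr -{2}(ger0_norm (hnorm_ge0 y)) -normrM mulrBl mul1r.
  by rewrite mulVf ?hnorm_eq0 // ltr_norml; apply/andP; split; lra.
have xz : hnorm (x - z) < a' *+ 2.
  by rewrite mulr2n (le_lt_trans (hdistD y x z)) // ltrD.
have zA : hnorm (z - orth_proj (central l r setT) z) < a / 2.
  apply: (QP H l r lr); split=> //; split=> // c Qc.
  have -> : l c z - r z c = comm_op l r c x - comm_op l r c (x - z).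
    by rewrite (comm_opB lr) opprB [RHS]addrC subrK.
  apply: (le_lt_trans (ler_hnormD _ _)); rewrite hnorm_opp.
  have xc : hnorm (comm_op l r c x) < d / 2.
    by have := xQ c (or_introl Qc); rewrite lt_min => /andP[].
  have := comm_op_le lr c (x - z).
  have : cnorm c * hnorm (x - z) <= M * (a' *+ 2).
    by rewrite ler_pM ?cnorm_ge0 ?hnorm_ge0 ?MP ?ltW.
  have : M * a' <= d / 8.
    move: a'd; rewrite ler_pdivlMr //; nra.
  rewrite [a' *+ 2]mulr2n [_ * _ *+ 2]mulr2n. lra.
(* The projection of [x] is at least as close to [x] as that of [z], whose distance is below
   [a / 2 + a / 2]. *)
have := orth_proj_le A_sub x (orth_proj_mem A_sub z).
have := hdistD z x (orth_proj (central l r setT) z).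
rewrite mulr2n in xz; lra.
Qed.

Theorem theorem4p6 (R : realType) (G : groupType) (B : cstarAlgType R)
    (act : G -> B -> B) (act_action : star_action act)
    (A : cstarAlgType R) (iota : B -> A) (u : G -> A)
    (A_full : full_crossed_product act iota u) :
  (property_T R G -> strongly_corigid (range iota)) /\
  (strong_property_T B -> property_T R G ->
     strong_property_T A /\
     forall (Ar : cstarAlgType R) (iotar : B -> Ar) (ur : G -> Ar),
       reduced_crossed_product act iotar ur -> strong_property_T Ar).
Proof.
have pair_T (D : cstarAlgType R) (i : B -> D) (v : G -> D) :
    covariant_pair act i v -> strong_property_T B -> property_T R G ->
    strong_property_T D.
  move=> pair BT GT; apply: (strong_property_T_corigid (pair_iota pair) BT).
  exact: crossed_product_corigid act_action pair GT.
case: A_full => pair _; split; first exact: crossed_product_corigid pair.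
move=> BT GT; split; first exact: pair_T pair BT GT.
by move=> Ar iotar ur [pairr _]; apply: pair_T pairr BT GT.
Qed.
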